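(* Let $\mathcal{D}$ be the set of all partitions into distinct parts (including the empty partition), and let $\mathcal{A}$ be the set of all partitions $\pi$ (including the empty partition) satisfying $p_2(\pi)\leq t(\pi)$. Then for $i=1$ and $i=2$ we have, as formal power series in $q$, \[ \sum_{\pi\in\mathcal{D}} w_i(\pi)\, q^{|\pi|} = \sum_{\pi\in \mathcal{A}} \hat{w}_i(\pi)\, q^{|\pi|}, \] where \[ w_i(\pi) = \left[1- f_1\left(\frac{1- (-1)^{t(\pi)}}{2}\right) \right](-1)^{i\, \#(\pi)}, \qquad \hat{w}_i(\pi) = 2^{r_2(\pi)}\left(\frac{(-1)^{t(\pi)}+(-1)^{p_2(\pi)}}{2} \right)(-1)^{(i-1) (r_1(\pi)+t(\pi)+p_2(\pi))}. \]
   Context: A partition $\pi$ is written in frequency notation $(1^{f_1},2^{f_2},3^{f_3},\dots)$ with $f_k\in\mathbb{Z}_{\ge0}$, all but finitely many zero; $f_k$ is the number of times the part $k$ occurs. It is distinct if all $f_k\le 1$. The size is $|\pi|=\sum_k k f_k$ and the number of parts is $\#(\pi)=\sum_k f_k$. The statistic $t(\pi)$ is the length of the initial frequency chain: the largest $t\ge 0$ such that $f_1,f_2,\dots,f_t$ are all nonzero (so $t(\pi)=0$ if $f_1=0$). For $j\ge1$, $p_j(\pi)$ is the largest index $k$ with $f_k\ge j$, and $p_j(\pi)=0$ if no such $k$ exists. For $j\ge 1$, $r_j(\pi)$ is the number of distinct part sizes $k$ with $f_k\ge j$. Example: for $\pi=(1^4,2^2,3^4,5^1,6^1)$, $|\pi|=31$,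 $\#(\pi)=12$, $t(\pi)=3$, $p_1(\pi)=6$, $p_2(\pi)=p_3(\pi)=p_4(\pi)=3$, $p_5(\pi)=0$, $r_1(\pi)=5$, $r_2(\pi)=3$, $r_3(\pi)=r_4(\pi)=2$, $r_5(\pi)=0$. *)

(* Defs.v *)
From HB Require Import structures.
From mathcomp Require Import all_boot all_order all_algebra.
From mathcomp Require Import finmap.

Set Implicit Arguments.
Unset Strict Implicit.
Unset Printing Implicit Defensive.

Import Order.TTheory GRing.Theory Num.Theory.
Local Open Scope ring_scope.

(* A partition in frequency notation: pi k is the number of times the part k
   occurs.  Since 0 is not a part, its frequency is required to vanish. *)
Record partition := Partition {
  freq :> {fsfun nat -> nat with 0%N};
  _ : freq 0%N == 0%N }.

HB.instance Definition _ := [isSub for freq].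
HB.instance Definition _ := [Countable of partition by <:].

(* The sums, maxima and cardinals below range over finsupp pi, the finite set
   of part sizes k with pi k != 0; the terms outside it contribute nothing. *)
Definition psize (pi : partition) : nat :=
  (\sum_(k <- finsupp pi) k * pi k)%N.

Definition nparts (pi : partition) : nat :=
  (\sum_(k <- finsupp pi) pi k)%N.

(* A chain f_1, ..., f_t of nonzero frequencies with t > 0 has t in the
   support, and the maximum is 0 if there is none; see leq_chain. *)
Definition chain (pi : partition) : nat :=
  (\max_(t <- finsupp pi | all (fun k => pi k != 0%N) (iota 1 t)) t)%N.

(* Meaningful for j >= 1. *)
Definition largest_part (j : nat) (pi : partition) : nat :=
  (\max_(k <- finsupp pi | (j <= pi k)%N) k)%N.

(* Meaningful for j >= 1. *)
Definition num_sizes (j : nat) (pi : partition) : nat :=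
  #|` [fset k in finsupp pi | (j <= pi k)%N]%fset|.

Definition distinct_parts (pi : partition) : bool :=
  all (fun k => pi k <= 1)%N (finsupp pi).

Definition class_D : pred partition := distinct_parts.

Definition class_A : pred partition :=
  fun pi => (largest_part 2 pi <= chain pi)%N.

Definition w (i : nat) (pi : partition) : rat :=
  (1 - (pi 1%N)%:R * ((1 - (-1) ^+ chain pi) / 2%:R)) * (-1) ^+ (i * nparts pi).

Definition w_hat (i : nat) (pi : partition) : rat :=
  2%:R ^+ num_sizes 2 pi
  * (((-1) ^+ chain pi + (-1) ^+ largest_part 2 pi) / 2%:R)
  * (-1) ^+ ((i - 1) * (num_sizes 1 pi + chain pi + largest_part 2 pi)).

(* In a partition of n, the part sizes are in [1, n] and their frequencies are
   at most n. *)
Definition freq_of_ffun n (g : {ffun 'I_n -> 'I_n.+1}) :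
    {fsfun nat -> nat with 0%N} :=
  [fsfun k in [fset k | k in iota 1 n]%fset =>
    if insub k.-1 is Some j then val (g j) else 0%N].

Lemma freq_of_ffun0 n (g : {ffun 'I_n -> 'I_n.+1}) :
  freq_of_ffun g 0%N == 0%N.
Proof. by rewrite /freq_of_ffun fsfunE !inE mem_iota. Qed.

Definition partitions_of (n : nat) : {fset partition} :=
  [fset pi in codom (fun g : {ffun 'I_n -> 'I_n.+1} =>
                       Partition (freq_of_ffun0 g)) | psize pi == n]%fset.

(* The power series \sum_(pi in P) v pi q^|pi|, as its coefficient sequence. *)
Definition genfun (P : pred partition) (v : partition -> rat) : nat -> rat :=
  fun n => \sum_(pi <- partitions_of n | P pi) v pi.

Lemma freq0 (pi : partition) : pi 0%N = 0%N.
Proof. by case: pi => f /= /eqP. Qed.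

Lemma mem_partitions_of n (pi : partition) :
  (pi \in partitions_of n) = (psize pi == n).
Proof.
rewrite !inE /=; case: eqP => [szpi | _]; last by rewrite andbF.
rewrite andbT.
have bound k : k \in finsupp pi -> (0 < k)%N /\ (k * pi k <= n)%N.
  move=> kpi; split.
    by rewrite lt0n; apply: contraTneq kpi => ->; rewrite mem_finsupp freq0.
  by rewrite -szpi /psize (big_fsetD1 k kpi) leq_addr.
have posf k : k \in finsupp pi -> (0 < pi k)%N by rewrite mem_finsupp lt0n.
apply/codomP; exists [ffun j : 'I_n => inord (pi j.+1)].
apply/val_inj/fsfunP => k /=; rewrite /freq_of_ffun fsfunE !inE mem_iota.
rewrite add1n ltnS.
case: (boolP (k \in finsupp pi)) => [kpi | kpi].
  have [k0 kn] := bound k kpi; have f0 := posf k kpi.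
  have lekn : (k <= n)%N by apply: leq_trans kn; rewrite leq_pmulr.
  rewrite k0 lekn /= insubT ?prednK // => lt_k.
  rewrite ffunE /= prednK // inordK // ltnS.
  by apply: leq_trans kn; rewrite leq_pmull.
rewrite (fsfun_dflt kpi); case: ifP => // /andP[k0 lekn].
rewrite insubT ?prednK // => lt_k.
by rewrite ffunE /= prednK // (fsfun_dflt kpi) inordK.
Qed.

Lemma leq_chain (pi : partition) t :
  reflect (forall k, (1 <= k <= t)%N -> pi k != 0%N) (t <= chain pi)%N.
Proof.
apply: (iffP idP) => [le_t k /andP[k1 kt] | nz].
  have: chain pi = 0%N \/
      all (fun k => pi k != 0%N) (iota 1 (chain pi)).
    rewrite /chain; elim/big_ind: _ => [|x y|i ai]; [by left | | by right].
    by case: (leqP x y).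
  case=> [c0|/allP]; first by move: (leq_trans k1 (leq_trans kt le_t)); rewrite c0.
  by apply; rewrite mem_iota k1 add1n ltnS (leq_trans kt le_t).
case: t nz => // t nz.
apply: (@leq_bigmax_seq _ _ _ id) => //.
  by rewrite mem_finsupp nz // leqnn.
by apply/allP => k; rewrite mem_iota add1n ltnS; apply: nz.
Qed.

(* Main.v *)
(* A signed sum over a range of lengths s splits both weights.  With z = (-1)^i
   and y = -z, and with t, p, # the statistics t(pi), p_2(pi), #(pi),
     w_i(pi) = z^# \sum_(s <= t) (-1)^s,
     [pi in A] w_hat_i(pi) = 2^(r_2) y^(r_1) \sum_(p <= s <= t) (-1)^s.
   For fixed s the condition on pi now bears on each frequency separately, so
   each generating function becomes a sum of products over the part sizes.  With
   P(z) = \prod_(k >= 1) (1 + z q^k), T_s = s(s+1)/2 and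
   B_s = \prod_(1 <= k <= s) (1 + q^k) / (1 - q^k), the claim is
     \sum_s (-z)^s q^(T_s) P(z q^s) = \sum_s z^s q^(T_s) B_s P(- z q^s),
   which holds for every z: both sides solve F(z) + z q F(z q) = P(z), and this
   functional equation has only one solution.  Power series up to degree n are
   computed in Q[X]/(X^(n+1)), that is, with q nilpotent. *)

Require Import Defs.
From mathcomp Require Import all_boot all_order all_algebra finmap qpoly ring.
(* finset also defines [partition]. *)
Import Defs.

Set Implicit Arguments.
Unset Strict Implicit.
Unset Printing Implicit Defensive.

Import Order.TTheory GRing.Theory Num.Theory.
Local Open Scope ring_scope.

(** * The series identity for nilpotent [q] *)

Section Nilpotent.
Variables (R : comNzRingType) (N : nat) (q : R).
Hypothesis qN : q ^+ N.+1 = 0.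

(* The factors of index k > N of the infinite product are 1. *)
Definition poch (z : R) : R := \prod_(k < N) (1 + z * q ^+ k.+1).

Definition theta (z : R) (t : nat) : R := z ^+ t * q ^+ 'C(t.+1, 2).

Lemma expq_eq0 m : (N < m)%N -> q ^+ m = 0.
Proof. by move=> ltNm; rewrite -(subnK ltNm) exprD qN mulr0. Qed.

Lemma poch0 : poch 0 = 1.
Proof. by apply: big1 => k _; rewrite mul0r addr0. Qed.

(** A further factor, of index N + 1, equals 1 since q^(N+1) = 0, so the truncated product obeys the
    exact functional equation. *)
Lemma poch_shift z : poch z = (1 + z * q) * poch (z * q).
Proof.
have -> : poch z = \prod_(k < N.+1) (1 + z * q ^+ k.+1).
  by rewrite big_ord_recr /= qN mulr0 addr0 mulr1.
rewrite big_ord_recl expr1; congr (_ * _).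
by apply: eq_bigr => k _; rewrite -mulrA -exprS.
Qed.


Lemma thetaS z t : theta z t.+1 = theta z t * (z * q ^+ t.+1).
Proof. by rewrite /theta binS bin1 exprSr exprD mulrACA. Qed.

Lemma theta_shift z t : theta (z * q) t = theta z t * q ^+ t.
Proof. by rewrite /theta exprMn mulrAC. Qed.

Lemma theta_shiftS z t : theta z t.+1 = z * q * theta (z * q) t.
Proof. rewrite thetaS theta_shift exprS; ring. Qed.

(** The triangular exponent is at least N + 1. Hence sums cut at t = N can be shifted by one without
    a boundary term. *)
Lemma theta_eq0 z : theta z N.+1 = 0.
Proof.
by rewrite /theta expq_eq0 ?mulr0 // binS bin1 leq_addl.
Qed.

Lemma sum_theta_shift z (f : nat -> R) :
  \sum_(t < N.+1) theta z t.+1 * f t =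
  \sum_(t < N.+1) theta z t * (if (t : nat) is t'.+1 then f t' else 0).
Proof.
by rewrite big_ord_recr big_ord_recl /= theta_eq0 mul0r mulr0 addr0 add0r.
Qed.

(** Each use of the equation extracts a factor q, and q^(N+1) = 0. *)
Lemma shift_uniq (f : R -> R) :
  (forall z, f z = - (z * q * f (z * q))) -> forall z, f z = 0.
Proof.
move=> fE z; suff [y ->] : exists y, f z = q ^+ N.+1 * y by rewrite qN mul0r.
elim: N.+1 z => [|k IHk] z; first by exists (f z); rewrite mul1r.
have [y yE] := IHk (z * q); exists (- (z * y)).
rewrite fE yE exprS; ring.
Qed.

(** Iteration carries the difference of [f] and [poch] from z to z q^(N+1) = 0, where both are 1. *)
Lemma shift_poch_uniq (f : R -> R) :
  f 0 = 1 -> (forall z, f z = (1 + z * q) * f (z * q)) -> f =1 poch.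
Proof.
move=> f0 fE z; apply/eqP; rewrite -subr_eq0.
suff [y ->] : exists y,
    f z - poch z = y * (f (z * q ^+ N.+1) - poch (z * q ^+ N.+1)).
  by rewrite qN mulr0 f0 poch0 subrr mulr0.
elim: N.+1 z => [|k IHk] z; first by exists 1; rewrite expr0 mulr1 mul1r.
have [y yE] := IHk (z * q); exists ((1 + z * q) * y).
by rewrite fE poch_shift exprS mulrA -mulrBr yE mulrA.
Qed.

Variable B : nat -> R.
Hypothesis B0 : B 0 = 1.
Hypothesis BS : forall t, B t.+1 * (1 - q ^+ t.+1) = B t * (1 + q ^+ t.+1).

Let D t := if t is t'.+1 then B t + B t' else B t.

(** Both sides equal 2 B_t. *)
Let DS t : D t.+1 * (1 - q ^+ t.+1) = D t * (1 + q ^+ t).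
Proof.
have -> : D t.+1 * (1 - q ^+ t.+1) = B t *+ 2 by rewrite /D mulrDl BS; ring.
case: t => [|t]; first by rewrite /D B0 expr0; ring.
rewrite /D mulrDl -BS; ring.
Qed.

(* K z is G z + z q G (z q), for the right-hand side G of theta_identity. *)
Let K z := \sum_(t < N.+1) theta z t * (D t * poch (- z * q ^+ t)).

Lemma sum_theta_D : K =1 poch.
Proof.
apply: shift_poch_uniq => [|z].
  rewrite /K big_ord_recl big1 => [|t _].
    by rewrite /theta /= B0 oppr0 mul0r poch0; ring.
  by rewrite /theta expr0n /= !mul0r.
(* The defect of K in the functional equation of poch vanishes by shift_uniq. *)
pose X z := \sum_(t < N.+1) theta z t *
   ((D t * (1 - q ^+ t) - D t * (z * q ^+ t.+1) *+ 2) * poch (- z * q ^+ t.+1)).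
have XE y : K y - (1 + y * q) * K (y * q) = X y.
  rewrite /K mulr_sumr -sumrB; apply: eq_bigr => t _.
  rewrite theta_shift (poch_shift (- y * q ^+ t)).
  rewrite -(mulrA (- y)) -exprSr.
  have -> : - (y * q) * q ^+ t = - y * q ^+ t.+1 by rewrite exprS; ring.
  rewrite exprS; ring.
have X0 : X z = 0.
  apply: shift_uniq => {}z; apply/eqP; rewrite -subr_eq0 opprK; apply/eqP.
  have -> : X z = \sum_(t < N.+1) theta z t.+1 * (
      (D t * (1 + q ^+ t) - D t *+ 2 * (1 - z * q ^+ t.+2))
      * poch (- z * q ^+ t.+2)).
    (* The factor z q^(t+1) raises [theta z t] to [theta z t.+1]. The other part has no term at t =
       0, as 1 - q^0 = 0, so it can be shifted to match, with [DS] for its coefficients. *)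
    transitivity (\sum_(t < N.+1) theta z t *
         (D t * (1 - q ^+ t) * poch (- z * q ^+ t.+1))
       - \sum_(t < N.+1) theta z t.+1 * (D t *+ 2 * poch (- z * q ^+ t.+1))).
      rewrite -sumrB; apply: eq_bigr => t _; rewrite thetaS; ring.
    rewrite big_ord_recl expr0 subrr mulr0 mul0r mulr0 add0r.
    rewrite [in LHS]big_ord_recr [in RHS]big_ord_recr /=
      theta_eq0 !mul0r !addr0.
    rewrite -sumrB; apply: eq_bigr => t _.
    rewrite /bump /= DS (poch_shift (- z * q ^+ t.+1)).
    rewrite -(mulrA (- z)) -exprSr.
    ring.
  (* Termwise, (1 + q^t) - 2 (1 - z q^(t+2)) + (1 - q^t) - 2 z q^(t+2) = 0. *)
  rewrite mulr_sumr -big_split big1 // => t _ /=.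
  rewrite theta_shiftS.
  have -> : - (z * q) * q ^+ t.+1 = - z * q ^+ t.+2 by rewrite !exprS; ring.
  rewrite !exprS; ring.
by apply/eqP; rewrite -subr_eq0 XE X0.
Qed.

Lemma theta_identity z :
  \sum_(t < N.+1) theta (- z) t * poch (z * q ^+ t) =
  \sum_(t < N.+1) theta z t * (B t * poch (- z * q ^+ t)).
Proof.
pose F z := \sum_(t < N.+1) theta (- z) t * poch (z * q ^+ t).
pose G z := \sum_(t < N.+1) theta z t * (B t * poch (- z * q ^+ t)).
have FE y : F y + y * q * F (y * q) = poch y.
  have -> : y * q * F (y * q) = - \sum_(t < N.+1)
      theta (- y) t.+1 * poch (y * q ^+ t.+1).
    rewrite mulr_sumr -sumrN; apply: eq_bigr => t _.
    by rewrite theta_shiftS exprS !mulrA !mulNr opprK.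
  (* Only the term t = 0, which is P(y), survives the cancellation. *)
  rewrite /F big_ord_recl [in X in _ - X]big_ord_recr /= theta_eq0 mul0r addr0.
  rewrite /theta !expr0 !mulr1 mul1r; exact: addrK.
have GE y : G y + y * q * G (y * q) = poch y.
  rewrite -sum_theta_D.
  have -> : y * q * G (y * q) = \sum_(t < N.+1)
      theta y t.+1 * (B t * poch (- y * q ^+ t.+1)).
    rewrite mulr_sumr; apply: eq_bigr => t _.
    by rewrite theta_shiftS exprS !mulrA !mulNr.
  rewrite (sum_theta_shift y (fun t => B t * poch (- y * q ^+ t.+1))) -big_split.
  apply: eq_bigr => -[[|t] lt_t] _ /=.
    by rewrite mulr0 addr0.
  rewrite /D; ring.
apply/eqP; rewrite -subr_eq0; apply/eqP.
apply: (shift_uniq (f := fun z => F z - G z)) => y.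
have /eqP := etrans (FE y) (esym (GE y)).
rewrite -subr_eq0 => /eqP E; rewrite -[RHS]add0r -E; ring.
Qed.

(** The last s factors on the left carry a power of q above N, hence are 1. *)
Lemma poch_tail z s :
  (s <= N)%N -> poch (z * q ^+ s) = \prod_(s <= j < N) (1 + z * q ^+ j.+1).
Proof.
move=> le_sN; rewrite /poch.
rewrite -(big_mkord xpredT (fun k => 1 + z * q ^+ s * q ^+ k.+1)).
rewrite (big_cat_nat (leq0n _) (leq_subr s N)) /= [X in _ * X]big_nat_cond.
rewrite [X in _ * X]big1 ?mulr1 => [|k /andP[/andP[lek _] _]].
  rewrite -[X in _ = \prod_(X <= _ < _) _]add0n big_addn; apply: eq_bigr => k _.
  by rewrite -mulrA -exprD addnC addSn.
by rewrite -mulrA -exprD expq_eq0 ?mulr0 ?addr0 // addnS ltnS -leq_subLR.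
Qed.

Lemma prod_theta z s : \prod_(j < s) (z * q ^+ j.+1) = theta z s.
Proof.
elim: s => [|s IHs]; first by rewrite big_ord0 /theta !expr0 mulr1.
by rewrite big_ord_recr /= IHs thetaS.
Qed.

Lemma geometric_inv k :
  (0 < k)%N -> (1 - q ^+ k) * \sum_(m < N.+1) q ^+ (k * m) = 1.
Proof.
move=> k0; under eq_bigr do rewrite exprM.
by rewrite -opprB mulNr -subrX1 -exprM expq_eq0 ?sub0r ?opprK // leq_pmull.
Qed.

(* The inner sum is the inverse of 1 - q^(j+1), see geometric_inv. *)
Definition oprod s :=
  \prod_(j < s) ((1 + q ^+ j.+1) * \sum_(m < N.+1) q ^+ (j.+1 * m)).

(** Supplies the hypothesis [BS] of [theta_identity]. *)
Lemma oprodS t : oprod t.+1 * (1 - q ^+ t.+1) = oprod t * (1 + q ^+ t.+1).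
Proof.
rewrite /oprod big_ord_recr /= -!mulrA.
by rewrite [X in _ * (_ * X)]mulrC geometric_inv ?mulr1.
Qed.

End Nilpotent.

(** * Split products, indicators and alternating sums *)

Lemma prod_ord_if (R : comNzRingType) (N s : nat) (f g : nat -> R) :
  (s <= N)%N ->
  \prod_(j < N) (if (j < s)%N then f j else g j) =
  (\prod_(j < s) f j) * \prod_(s <= j < N) g j.
Proof.
move=> le_sN.
rewrite -(big_mkord xpredT (fun j => if (j < s)%N then f j else g j)).
rewrite (big_cat_nat (leq0n _) le_sN) /= big_mkord; congr (_ * _).
  by apply: eq_bigr => j _; rewrite ltn_ord.
by apply: eq_big_nat => j /andP[le_sj _]; rewrite ltnNge le_sj.
Qed.

Lemma prodr_natb (R : comNzRingType) (I : finType) (b : pred I) :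
  \prod_i (b i)%:R = [forall i, b i]%:R :> R.
Proof.
case: forallP => [bT | /forallP]; first by apply: big1 => i _; rewrite bT.
by rewrite negb_forall => /existsP[i /negPf bi]; rewrite (bigD1 i) //= bi mul0r.
Qed.

(** Consecutive signs cancel in pairs. This produces the averaged signs of [w_hat] and, with p = 0,
    those of [w]. *)
Lemma sum_alternating (n p t : nat) : (t <= n)%N ->
  \sum_(s < n.+1) (-1) ^+ s * (p <= s <= t)%:R =
  (p <= t)%:R * (((-1) ^+ t + (-1) ^+ p) / 2%:R) :> rat.
Proof.
move=> le_tn; case: (leqP p t) => [le_pt | lt_tp]; last first.
  rewrite mul0r big1 // => s _.
  case: andP => [[ps st]|_]; last by rewrite mulr0.
  by move: (leq_trans lt_tp (leq_trans ps st)); rewrite ltnn.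
rewrite mul1r -(big_mkord xpredT (fun s => (-1) ^+ s * (p <= s <= t)%:R)).
rewrite (big_cat_nat (leq0n _) (leqW (leq_trans le_pt le_tn))) /=.
rewrite big_nat big1 ?add0r => [|s /andP[_ lt_sp]]; last first.
  by rewrite leqNgt lt_sp mulr0.
rewrite (big_cat_nat (leqW le_pt) (_ : t.+1 <= n.+1)%N) //=.
rewrite [X in _ + X]big_nat [X in _ + X]big1 ?addr0; last first.
  by move=> s /andP[lt_ts _]; rewrite [(s <= t)%N]leqNgt lt_ts andbF mulr0.
transitivity (\sum_(p <= s < t.+1) (-1) ^+ s : rat).
  by apply: eq_big_nat => s; rewrite ltnS => ->; rewrite mulr1.
rewrite -(subnK le_pt); elim: (t - p)%N => [|d IHd].
  by rewrite add0n big_nat1; field.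
rewrite addSn big_nat_recr /=; last by rewrite leqW ?leq_addl.
by rewrite IHd exprS; field.
Qed.

(** * Statistics of a partition with parts at most [n]; the index j stands for the part j + 1 *)

Section Partitions.
Variables (n : nat) (pi : partition).
Hypothesis supp : forall k, (n < k)%N -> pi k = 0%N.

Lemma big_finsupp (R : nmodType) (F : nat -> R) :
  (forall k, pi k = 0%N -> F k = 0) ->
  \sum_(k <- finsupp pi) F k = \sum_(j < n) F j.+1.
Proof.
move=> F0; rewrite -(big_mkord xpredT (fun j => F j.+1)).
rewrite -(big_add1 _ _ 0 n.+1 xpredT F) /index_iota subSS subn0.
rewrite [RHS](bigID (mem (finsupp pi)) xpredT) /= [X in _ = _ + X]big1 ?addr0.
  rewrite -[RHS]big_filter; apply: perm_big; apply: uniq_perm.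
  - exact: fset_uniq.
  - exact/filter_uniq/iota_uniq.
  move=> k; rewrite mem_filter mem_iota add1n ltnS andbC.
  case: (boolP (k \in finsupp pi)); rewrite ?andbF // mem_finsupp andbT => nzk.
  rewrite lt0n leqNgt; apply/esym/andP; split.
    by apply: contraNneq nzk => ->; rewrite freq0.
  by apply: contraNN nzk => /supp ->.
by move=> k; rewrite memNfinsupp => /eqP/F0.
Qed.

Lemma psizeE : psize pi = (\sum_(j < n) j.+1 * pi j.+1)%N.
Proof. by apply: (@big_finsupp nat) => k ->; rewrite muln0. Qed.

Lemma npartsE : nparts pi = (\sum_(j < n) pi j.+1)%N.
Proof. exact: (@big_finsupp nat). Qed.

Lemma num_sizesE r : (0 < r)%N ->
  num_sizes r pi = (\sum_(j < n) (r <= pi j.+1))%N.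
Proof.
move=> r0; rewrite -(@big_finsupp nat (fun k => (r <= pi k)%N : nat)) => [|k ->].
  under [RHS]eq_bigr do rewrite -[nat_of_bool _]mul1n mulnbr.
  rewrite -big_mkcond sum1_count -size_filter; apply/perm_size/uniq_perm.
  - exact: fset_uniq.
  - exact/filter_uniq/fset_uniq.
  by move=> k; rewrite mem_filter !inE andbC.
by rewrite leqNgt r0.
Qed.

Lemma chain_le : (chain pi <= n)%N.
Proof.
apply/bigmax_leqP_seq => k; rewrite mem_finsupp leqNgt => nzk _.
by apply: contraNN nzk => /supp ->.
Qed.

Lemma class_D_chainE s : (s <= n)%N ->
  [forall j : 'I_n, (pi j.+1 <= 1)%N && ((j < s)%N ==> (pi j.+1 != 0%N))] =
  class_D pi && (s <= chain pi)%N.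
Proof.
move=> le_sn; apply/forallP/andP => [H | [/allP D1 /leq_chain sT] j].
  split.
    apply/allP => -[|k]; first by rewrite freq0.
    case: (ltnP k n) => [lt_kn _ | le_nk]; last by rewrite mem_finsupp supp.
    by case/andP: (H (Ordinal lt_kn)).
  apply/leq_chain => -[|k] //= lt_ks.
  by case/andP: (H (Ordinal (leq_trans lt_ks le_sn))) => _ /implyP; apply.
apply/andP; split; last by apply/implyP => lt_js; apply: sT.
by case: (boolP (j.+1 \in finsupp pi)) => [/D1 // | /fsfun_dflt ->].
Qed.

(** p_2 <= s bounds the frequencies beyond s by 1, and s <= t makes those up to s nonzero: one
    condition per part size. *)
Lemma class_A_chainE s : (s <= n)%N ->
  [forall j : 'I_n, if (j < s)%N then pi j.+1 != 0%N else (pi j.+1 <= 1)%N] =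
  (largest_part 2 pi <= s <= chain pi)%N.
Proof.
move=> le_sn; apply/forallP/andP => [H | [/bigmax_leqP_seq ps /leq_chain sT] j].
  split.
    apply/bigmax_leqP_seq => -[|k] //; rewrite mem_finsupp => nzk lt1.
    case: (ltnP k n) => [lt_kn | le_nk]; last by rewrite supp in nzk.
    by have := H (Ordinal lt_kn) => /=; case: ltnP => // _; rewrite leqNgt lt1.
  apply/leq_chain => -[|k] //= lt_ks.
  by have := H (Ordinal (leq_trans lt_ks le_sn)) => /=; rewrite lt_ks.
case: ltnP => [lt_js | le_sj]; first exact: sT.
rewrite leqNgt; apply/negP => lt1.
have := ps j.+1; rewrite mem_finsupp -lt0n (ltnW lt1) => /(_ isT lt1).
by rewrite ltnNge le_sj.
Qed.

End Partitions.

(** * Both weights as signed sums of products *)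

Section Weights.
Variables (n : nat) (pi : partition).
Hypothesis supp : forall k, (n < k)%N -> pi k = 0%N.

(* In weightD and weightA, the contribution to the s-th term of the sum over
   chain lengths of a part size j+1 of frequency m. *)
Definition weightD (z : rat) (s j m : nat) : rat :=
  ((m <= 1) && ((j < s) ==> (m != 0)))%N%:R * z ^+ m.

Definition weightA (y : rat) (s j m : nat) : rat :=
  (if (j < s)%N then m != 0%N else (m <= 1)%N)%:R
  * (2%:R ^+ (2 <= m)%N * y ^+ (1 <= m)%N).

(** For distinct parts, f_1 is 1 if t > 0 and 0 if t = 0, so the bracket in [w] is (1 + (-1)^t) / 2
    in both cases. *)
Lemma w_sum i :
  (class_D pi)%:R * w i pi =
  \sum_(s < n.+1) (-1) ^+ s * \prod_(j < n) weightD ((-1) ^+ i) s j (pi j.+1).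
Proof.
pose c := \sum_(s < n.+1) (-1) ^+ s * (0 <= s <= chain pi)%N%:R : rat.
transitivity ((class_D pi)%:R * (c * (-1) ^+ (i * nparts pi))).
  case: (boolP (class_D pi)) => [/allP D1 | _]; last by rewrite !mul0r.
  rewrite !mul1r /c sum_alternating ?chain_le // leq0n mul1r expr0 /w.
  congr (_ * _).
  have: (pi 1%N <= 1)%N.
    by case: (boolP (1%N \in finsupp pi)) => [/D1 // | /fsfun_dflt ->].
  have chain0 : pi 1%N = 0%N -> chain pi = 0%N.
    move=> f0; apply/eqP; rewrite -leqn0 leqNgt.
    apply/negP => /leq_chain/(_ 1%N isT).
    by rewrite f0.
  case: (pi 1%N) chain0 => [/(_ erefl) -> _ | [|] // _ _].
    by rewrite expr0; field.
  by field.
rewrite mulrCA /c mulr_suml; apply: eq_bigr => s _.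
rewrite big_split /= prodr_natb class_D_chainE // ?leq_ord //.
by rewrite prodrXr -npartsE // -exprM -mulnb natrM -!mulrA;
  congr (_ * _); rewrite mulrCA.
Qed.

(** Since i > 0, the subtraction i - 1 is not truncated and -(-1)^i = (-1)^(i-1). *)
Lemma w_hat_sum i : (0 < i)%N ->
  (class_A pi)%:R * w_hat i pi =
  \sum_(s < n.+1) (-1) ^+ s * \prod_(j < n) weightA (- (-1) ^+ i) s j (pi j.+1).
Proof.
case: i => // i _; rewrite exprS mulN1r opprK.
transitivity (\sum_(s < n.+1)
   (-1) ^+ s * (largest_part 2 pi <= s <= chain pi)%N%:R
   * (2%:R ^+ num_sizes 2 pi * (-1) ^+ (i * num_sizes 1 pi)) : rat).
  rewrite -mulr_suml sum_alternating ?chain_le // /class_A -mulrA.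
  congr (_ * _).
  (* The average vanishes unless a and b have the same parity, and then the sign is 1. *)
  have sign_absorb (a b : nat) :
     ((-1) ^+ a + (-1) ^+ b) / 2%:R * (-1) ^+ (i * (a + b)) =
     ((-1) ^+ a + (-1) ^+ b) / 2%:R :> rat.
    rewrite mulnC exprM -(signr_odd _ (a + b)) oddD.
    rewrite -(signr_odd _ a) -(signr_odd _ b).
    by case: (odd a); case: (odd b);
      rewrite /= ?expr1n ?mulr1 // ?addNr ?addrN ?mul0r.
  by rewrite /w_hat subSS subn0 -addnA mulnDr exprD mulrACA sign_absorb mulrC.
apply: eq_bigr => s _. rewrite /weightA !big_split /=
  prodr_natb class_A_chainE ?leq_ord //.
by rewrite !prodrXr -!(num_sizesE supp) // -exprM !mulrA.
Qed.

End Weights.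

(** * Partitions with parts and frequencies at most [n] *)

Section Box.
Variable n : nat.

Definition partition_of_ffun (g : {ffun 'I_n -> 'I_n.+1}) : partition :=
  Partition (freq_of_ffun0 g).

Lemma partition_of_ffunE g (j : 'I_n) : partition_of_ffun g j.+1 = g j.
Proof.
rewrite /= /freq_of_ffun fsfunE !inE mem_iota /= add1n ltnS ltn_ord.
by rewrite valK.
Qed.

Lemma partition_of_ffun_supp g k : (n < k)%N -> partition_of_ffun g k = 0%N.
Proof.
move=> lt_nk; rewrite /= /freq_of_ffun fsfunE !inE mem_iota add1n ltnS.
by rewrite [(k <= n)%N]leqNgt lt_nk andbF.
Qed.

Lemma partition_of_ffun_inj : injective partition_of_ffun.
Proof.
move=> g h E; apply/ffunP => j; apply/val_inj.
by rewrite /= -!partition_of_ffunE E.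
Qed.

Lemma genfun_ffun (P : pred partition) v :
  genfun P v n =
  \sum_(g | psize (partition_of_ffun g) == n)
     (P (partition_of_ffun g))%:R * v (partition_of_ffun g).
Proof.
rewrite /genfun big_mkcond.
under eq_bigr do rewrite -mulrb -mulr_natl.
rewrite -[RHS]big_filter.
rewrite -(big_map partition_of_ffun xpredT (fun pi => (P pi)%:R * v pi)).
apply: perm_big; apply: uniq_perm; first exact: fset_uniq.
  rewrite map_inj_uniq ?filter_uniq ?index_enum_uniq //.
  exact: partition_of_ffun_inj.
move=> pi; rewrite !inE; apply/andP/mapP => [[/codomP[g ->] /= szg] | [g]].
  by exists g => //; rewrite mem_filter szg mem_index_enum.
by rewrite mem_filter => /andP[szg _] ->; split=> //; apply: codom_f.
Qed.

(** Distributivity: choosing a frequency for each part size amounts to choosing [g], which no size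
    condition restricts. *)
Lemma sum_partition_of_ffun (A : comAlgType rat) (q : A) (u : partition -> rat)
    (c : nat -> nat -> nat -> rat) :
  (forall pi : partition, (forall k, (n < k)%N -> pi k = 0%N) ->
    u pi = \sum_(s < n.+1) (-1) ^+ s * \prod_(j < n) c s j (pi j.+1)) ->
  \sum_g u (partition_of_ffun g) *: q ^+ psize (partition_of_ffun g) =
  \sum_(s < n.+1) (-1) ^+ s *:
     \prod_(j < n) \sum_(m < n.+1) c s j m *: q ^+ (j.+1 * m).
Proof.
move=> uE.
under [RHS]eq_bigr do rewrite bigA_distr_bigA scaler_sumr.
rewrite exchange_big; apply: eq_bigr => g _ /=.
have supp := @partition_of_ffun_supp g.
rewrite uE // scaler_suml; apply: eq_bigr => s _.
rewrite scaler_prod scalerA (psizeE supp) -prodrXr; congr (_ *: _).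
  by congr (_ * _); apply: eq_bigr => j _; rewrite partition_of_ffunE.
by apply: eq_bigr => j _; rewrite partition_of_ffunE.
Qed.

End Box.

(** * Coefficients modulo X^(n+1) *)

Section Quotient.
Variable n : nat.
Local Notation h := ('X^(n.+1) : {poly rat}).

Lemma coef_in_qpoly (p : {poly rat}) : (in_qpoly h p)`_n = p`_n.
Proof.
rewrite /in_qpoly /= mk_monic_Xn /=.
rewrite [in RHS](Pdiv.RingMonic.rdivp_eq (monicXn _ n.+1) p) coefD coefMXn.
by rewrite ltnSn add0r.
Qed.

Lemma qX_expn : (in_qpoly h 'X) ^+ n.+1 = 0.
Proof.
rewrite -rmorphXn; apply/val_inj => /=.
by rewrite mk_monic_Xn /= Pdiv.RingMonic.rmodpp ?monicXn.
Qed.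

(** The box also holds partitions of other sizes, but these do not contribute in degree n. *)
Lemma genfun_coef (P : pred partition) v :
  genfun P v n =
  (\sum_g ((P (partition_of_ffun g))%:R * v (partition_of_ffun g))
     *: (in_qpoly h 'X) ^+ psize (@partition_of_ffun n g))`_n.
Proof.
under eq_bigr do rewrite -rmorphXn -linearZ.
rewrite -linear_sum coef_in_qpoly coef_sum genfun_ffun big_mkcond.
apply: eq_bigr => g _; rewrite coefZ coefXn eq_sym.
by case: ifP; rewrite ?mulr1 ?mulr0.
Qed.

End Quotient.

(** * Evaluation of the products over part sizes *)

Section Products.
Variables (A : comAlgType rat) (n : nat) (q : A).
Hypothesis qn : q ^+ n.+1 = 0.

(** The ordinal [j] ensures n > 0, so that the index 1 is in range. *)
Lemma sum_ord_distinct (f : nat -> A) (j : 'I_n) :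
  (forall m, (1 < m)%N -> f m = 0) -> \sum_(m < n.+1) f m = f 0%N + f 1%N.
Proof.
case: n j => [[] //|n' _] f0; rewrite !big_ord_recl big1 ?addr0 //= => m _.
exact: f0.
Qed.

(** A size k <= s occurs exactly once and gives z q^k; a larger one gives 1 + z q^k. *)
Lemma prod_weightD (z : rat) s : (s <= n)%N ->
  \prod_(j < n) \sum_(m < n.+1) weightD z s j m *: q ^+ (j.+1 * m) =
  theta q z%:A s * poch n q (z%:A * q ^+ s).
Proof.
move=> le_sn; rewrite poch_tail // -prod_theta.
rewrite -(prod_ord_if (fun j => z%:A * q ^+ j.+1)
  (fun j => 1 + z%:A * q ^+ j.+1)) //.
apply: eq_bigr => j _.
rewrite (sum_ord_distinct (f := fun m => weightD z s j m *: q ^+ (j.+1 * m)) j).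
  rewrite /weightD muln0 muln1 /= implybT implybF.
  by case: ltnP => _ /=;
    rewrite ?mul0r ?mul1r ?scale0r ?scale1r ?add0r mulr_algl.
by case=> [|[|m]] // _; rewrite /weightD mul0r scale0r.
Qed.

(** A size k <= s gives y (q^k + 2 q^(2k) + 2 q^(3k) + ...) = y q^k (1 + q^k) / (1 - q^k). *)
Lemma prod_weightA (y : rat) s : (s <= n)%N ->
  \prod_(j < n) \sum_(m < n.+1) weightA y s j m *: q ^+ (j.+1 * m) =
  theta q y%:A s * oprod n q s * poch n q (y%:A * q ^+ s).
Proof.
move=> le_sn; rewrite poch_tail // -prod_theta /oprod -big_split /=.
rewrite -(prod_ord_if (fun j => y%:A * q ^+ j.+1 *
  ((1 + q ^+ j.+1) * \sum_(m < n.+1) q ^+ (j.+1 * m)))) //.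
apply: eq_bigr => j _; rewrite /weightA; case: ltnP => [lt_js | le_sj].
  set k := j.+1; set e := \sum_(m < _) q ^+ _.
  have inv_e : e - 1 = q ^+ k * e.
    by rewrite -(geometric_inv qn (ltn0Sn j)) mulrBl mul1r opprB addrC subrK.
  (* 2 (e - 1) gives weight 2 to every m >= 1; subtracting q^k restores weight 1 at m = 1. *)
  have -> : y%:A * q ^+ k * ((1 + q ^+ k) * e) = y%:A * ((e - 1) *+ 2 - q ^+ k).
    rewrite -mulrA; congr (_ * _).
    by rewrite mulrCA -inv_e mulrDl mul1r mulrBr mulr1 -inv_e; ring.
  have n0 : (0 < n)%N by apply: leq_trans (ltn_ord j).
  rewrite /e -(prednK n0) !big_ord_recl /= !muln0 muln1.
  rewrite mul0r scale0r add0r !mul1r !expr0 !expr1 -scaler_sumr mulr_algl.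
  rewrite [2%:R * y]mulrC -scalerA -scalerDr scaler_nat; congr (_ *: _); ring.
rewrite (sum_ord_distinct (f := fun m =>
  ((m <= 1)%N%:R * (2 ^+ (1 < m)%N * y ^+ (0 < m)%N)) *: q ^+ (j.+1 * m)) j).
  by rewrite muln0 muln1 /= !mul1r scale1r mulr_algl.
by case=> [|[|m]] // _; rewrite mul0r scale0r.
Qed.

End Products.

(** * Comparison of the two generating functions *)

Lemma genfun_w_hat (i n : nat) : (0 < i)%N ->
  genfun class_D (w i) n = genfun class_A (w_hat i) n.
Proof.
(* Equality is proved in the quotient ring itself, not only for the coefficient of degree n. *)
move=> i0; rewrite !genfun_coef; congr (polyseq _)`_n; congr val.
have qn := qX_expn n; set q := in_qpoly _ _ in qn *.
rewrite (sum_partition_of_ffun (u := fun pi => (class_D pi)%:R * w i pi) q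
  (fun pi supp => w_sum supp i)).
rewrite (sum_partition_of_ffun (u := fun pi => (class_A pi)%:R * w_hat i pi) q
  (fun pi supp => w_hat_sum supp i0)).
set z := (-1) ^+ i.
have oprod0 : oprod n q 0 = 1 by rewrite /oprod big_ord0.
(* The sign (-1)^s turns z into -z on the side of [class_D], and y = -z into z on the side of
   [class_A]. *)
have thetaN (y : rat) s : (-1) ^+ s *: theta q y%:A s = theta q (- y%:A) s.
  by rewrite /theta [in RHS]exprNn -mulrA -[in LHS]signr_odd -[in RHS]signr_odd;
    case: (odd s); rewrite ?scaleN1r ?scale1r ?mulN1r ?mul1r.
transitivity (\sum_(t < n.+1) theta q (- z%:A) t * poch n q (z%:A * q ^+ t)).
  by apply: eq_bigr => s _; rewrite prod_weightD ?leq_ord // scalerAl thetaN.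
rewrite (theta_identity qn oprod0 (oprodS qn)).
apply: eq_bigr => s _; rewrite prod_weightA ?leq_ord //.
by rewrite -[X in _ = _ *: X]mulrA scalerAl thetaN scaleNr opprK.
Qed.

Local Close Scope ring_scope.

Theorem theorem3p1 (i : nat) (hi : i = 1 \/ i = 2) :
  genfun class_D (w i) =1 genfun class_A (w_hat i).
Proof. by move=> n; apply: genfun_w_hat; case: hi => ->. Qed.
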